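(* Let $n\ge 2$ and let $i,j\in\{1,\dots,n\}$ with $i\neq j$. Then the map $w^p_{ij}:G_{n,p}^2\to F_n^2$ is well defined; that is, if two words in the generators $a_{st}^{\epsilon}$ represent the same element of $G_{n,p}^2$, then the values of $w^p_{ij}$ on these two words are equal in $F_n^2$.
   Context: **The group $G_{n,p}^2$.** $G_{n,p}^2$ is the group with generators $a_{st}^{\epsilon}$, where $\{s,t\}\subset\{1,\dots,n\}$ is a $2$-element subset (so $a_{st}^\epsilon=a_{ts}^\epsilon$) and $\epsilon\in\{0,1\}$ is a superscript label (not a power), subject to: (1) $(a_{st}^{\epsilon})^2=1$; (2) $a_{st}^{\epsilon}a_{uv}^{\epsilon'}=a_{uv}^{\epsilon'}a_{st}^{\epsilon}$ for distinct $s,t,u,v$ and all $\epsilon,\epsilon'\in\{0,1\}$; (3) $a_{st}^{\epsilon_{st}}a_{su}^{\epsilon_{su}}a_{tu}^{\epsilon_{tu}}=a_{tu}^{\epsilon_{tu}}a_{su}^{\epsilon_{su}}a_{st}^{\epsilon_{st}}$ for distinct $s,t,u$ whenever $\epsilon_{st}+\epsilon_{su}+\epsilon_{tu}\equiv0\pmod 2$. **The group $F_n^2$.** For fixed $i\ne j$, $F_n^2$ is the group generated by all maps $\sigma:\{1,\dots,n\}\setminus\{i,j\}\to\mathbb{Z}_2$ with relations $\sigma^2=1$ for each $\sigma$ (a free product of $2^{n-2}$ copies of $\mathbb{Z}_2$). **The map $w^p_{ij}$.** Given a word $\beta$ in the generators of $G_{n,p}^2$, let $c_1,\dots,c_m$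 be, from left to right, all occurrences of letters $a_{ij}^{\epsilon}$ ($\epsilon\in\{0,1\}$) in $\beta$. For such an occurrence $c$ of $a_{ij}^{\epsilon}$ and $k\in\{1,\dots,n\}\setminus\{i,j\}$ set $$i^p_{c}(k)=\begin{cases}N_{ik}^0+N_{jk}^0 \bmod 2 & \text{if }\epsilon=0,\\ N_{ik}^0+N_{jk}^1\bmod 2&\text{if }\epsilon=1,\end{cases}$$ where $N_{st}^{\delta}$ is the number of occurrences of $a_{st}^{\delta}$ appearing before $c$ in $\beta$. Thus $i^p_c$ is a generator of $F_n^2$, and $w^p_{ij}(\beta)=\prod_{s=1}^m i^p_{c_s}=i^p_{c_1}\cdots i^p_{c_m}\in F_n^2$. *)

(* Defs.v *)
From HB Require Import structures.
From mathcomp Require Import all_boot all_algebra.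
From mathcomp Require Import boolp.

Set Implicit Arguments.
Unset Strict Implicit.
Unset Printing Implicit Defensive.

Local Open Scope group_scope.

(* The letter (x, false) stands for x and (x, true) for its formal inverse. *)
Definition sword (X : Type) := seq (X * bool).

Definition pos (X : Type) (u : seq X) : sword X := [seq (x, false) | x <- u].

Definition sinv (X : Type) (u : sword X) : sword X :=
  rev [seq (x.1, ~~ x.2) | x <- u].

(* The congruence on signed words generated by free cancellation and by the
   equations u = v such that rel u v. *)
Inductive pres_eq (X : Type) (rel : seq X -> seq X -> Prop) :
    sword X -> sword X -> Prop :=
| pres_refl u : pres_eq rel u u
| pres_sym u v : pres_eq rel u v -> pres_eq rel v u
| pres_trans u v w : pres_eq rel u v -> pres_eq rel v w -> pres_eq rel u w
| pres_cat u u' v v' :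
    pres_eq rel u u' -> pres_eq rel v v' -> pres_eq rel (u ++ v) (u' ++ v')
| pres_cancel x b : pres_eq rel [:: (x, b); (x, ~~ b)] [::]
| pres_rel u v : rel u v -> pres_eq rel (pos u) (pos v).

Section Presented.
Variables (X : choiceType) (rel : seq X -> seq X -> Prop).

Definition pres_eqb (u v : sword X) : bool := `[< pres_eq rel u v >].

Fact pres_eqb_refl : reflexive pres_eqb.
Proof. by move=> u; apply/asboolP; apply: pres_refl. Qed.

Fact pres_eqb_sym : symmetric pres_eqb.
Proof. by move=> u v; apply/asboolP/asboolP; apply: pres_sym. Qed.

Fact pres_eqb_trans : transitive pres_eqb.
Proof.
move=> v u w /asboolP uv /asboolP vw; apply/asboolP.
exact: pres_trans uv vw.
Qed.

Canonical pres_equiv :=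
  EquivRel pres_eqb pres_eqb_refl pres_eqb_sym pres_eqb_trans.

Definition presented := {eq_quot pres_equiv}%qT.

HB.instance Definition _ := Choice.on presented.
HB.instance Definition _ := Quotient.on presented.

Definition pres_class (u : sword X) : presented := (\pi_presented u)%qT.

Lemma pres_classP u v : pres_class u = pres_class v <-> pres_eq rel u v.
Proof.
split=> [/eqmodP/asboolP //|uv].
by apply/eqmodP; apply/asboolP.
Qed.

Lemma sinvK : involutive (@sinv X).
Proof.
move=> u; rewrite /sinv map_rev revK -map_comp map_id_in //.
by case=> x b _ /=; rewrite negbK.
Qed.

Lemma sinv_cat u v : sinv (u ++ v) = sinv v ++ sinv u :> sword X.
Proof. by rewrite /sinv map_cat rev_cat. Qed.

Lemma pres_eq_catVr u : pres_eq rel (u ++ sinv u) [::].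
Proof.
elim: u => [|[x b] u IHu]; first exact: pres_refl.
have -> : ((x, b) :: u) ++ sinv ((x, b) :: u) =
          ([:: (x, b)] ++ (u ++ sinv u)) ++ [:: (x, ~~ b)].
  by rewrite /sinv /= rev_cons -cats1 !catA.
apply: pres_trans (pres_cancel rel x b).
rewrite -[[:: (x, b); (x, ~~ b)]]/(([:: (x, b)] ++ [::]) ++ [:: (x, ~~ b)]).
by do 2?[apply: pres_cat; try exact: pres_refl].
Qed.

Lemma pres_eq_catVl u : pres_eq rel (sinv u ++ u) [::].
Proof. by rewrite -{2}[u]sinvK; apply: pres_eq_catVr. Qed.

Lemma pres_eq_sinv u v : pres_eq rel u v -> pres_eq rel (sinv u) (sinv v).
Proof.
move=> uv; apply: (@pres_trans _ _ _ (sinv u ++ (v ++ sinv v))).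
  rewrite -{1}[sinv u]cats0; apply: pres_cat; first exact: pres_refl.
  exact/pres_sym/pres_eq_catVr.
rewrite catA -{2}[sinv v]cat0s; apply: pres_cat; last exact: pres_refl.
apply: pres_trans (pres_eq_catVl u).
by apply: pres_cat; [apply: pres_refl | apply: pres_sym].
Qed.

Definition pres_one : presented := pres_class [::].
Definition pres_mul (a b : presented) := pres_class (repr a ++ repr b).
Definition pres_inv (a : presented) := pres_class (sinv (repr a)).

Lemma pres_repr u : pres_eq rel (repr (pres_class u)) u.
Proof. by apply/pres_classP; rewrite /pres_class reprK. Qed.

Lemma pres_mulE u v :
  pres_mul (pres_class u) (pres_class v) = pres_class (u ++ v).
Proof. by apply/pres_classP; apply: pres_cat; apply: pres_repr. Qed.

Lemma pres_invE u : pres_inv (pres_class u) = pres_class (sinv u).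
Proof. by apply/pres_classP; apply: pres_eq_sinv; apply: pres_repr. Qed.

Lemma pres_classW (P : presented -> Prop) :
  (forall u, P (pres_class u)) -> forall a, P a.
Proof. by move=> Pu a; rewrite -[a]reprK; apply: Pu. Qed.

Fact pres_mulA : associative pres_mul.
Proof.
elim/pres_classW=> u; elim/pres_classW=> v; elim/pres_classW=> w.
by rewrite !pres_mulE catA.
Qed.

Fact pres_mul1 : left_id pres_one pres_mul.
Proof. by elim/pres_classW=> u; rewrite pres_mulE. Qed.

Fact pres_mulr1 : right_id pres_one pres_mul.
Proof. by elim/pres_classW=> u; rewrite pres_mulE cats0. Qed.

Fact pres_mulV : left_inverse pres_one pres_inv pres_mul.
Proof.
elim/pres_classW=> u; rewrite pres_invE pres_mulE.
by apply/pres_classP; apply: pres_eq_catVl.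
Qed.

Fact pres_mulrV : right_inverse pres_one pres_inv pres_mul.
Proof.
elim/pres_classW=> u; rewrite pres_invE pres_mulE.
by apply/pres_classP; apply: pres_eq_catVr.
Qed.

HB.instance Definition _ := isGroup.Build presented
  pres_mulA pres_mul1 pres_mulr1 pres_mulV pres_mulrV.

Definition pgen (x : X) : presented := pres_class [:: (x, false)].

Lemma pres_class_pos (u : seq X) : pres_class (pos u) = \prod_(x <- u) pgen x.
Proof.
elim: u => [|x u IHu]; first by rewrite big_nil.
by rewrite big_cons -IHu /pgen; symmetry; apply: pres_mulE.
Qed.

Lemma presented_rel (u v : seq X) :
  rel u v -> \prod_(x <- u) pgen x = \prod_(x <- v) pgen x.
Proof.
by move=> uv; rewrite -!pres_class_pos; apply/pres_classP/pres_rel.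
Qed.

Lemma presented_univ (H : groupType) (f : X -> H) :
    (forall u v, rel u v -> \prod_(x <- u) f x = \prod_(x <- v) f x) ->
  exists phi : presented -> H,
    {morph phi : a b / a * b} /\ forall x, phi (pgen x) = f x.
Proof.
move=> frel.
pose g (y : X * bool) := if y.2 then (f y.1)^-1 else f y.1.
pose ev (u : sword X) := \prod_(y <- u) g y.
have ev_eq u v : pres_eq rel u v -> ev u = ev v.
  elim=> {u v} [u|u v _ -> //|u v w _ -> //|u u' v v' _ e _ e'|x b|u v /frel e].
  - by [].
  - by rewrite /ev !big_cat /= -/(ev u) -/(ev v) e e'.
  - by rewrite /ev !big_cons big_nil /g; case: b; rewrite /= mulg1 ?mulVg ?mulgV.
  - by rewrite /ev /pos !big_map.
exists (fun a => ev (repr a)); split=> [|x]; last first.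
  by rewrite (ev_eq _ _ (pres_repr _)) /ev big_cons big_nil mulg1.
move=> a b; rewrite -[RHS]big_cat; exact/ev_eq/pres_repr.
Qed.

End Presented.

(* The index set {1, ..., n} is represented by 'I_n, and the superscript labels
   0 and 1 by false and true. *)

Definition edge (n : nat) := {A : {set 'I_n} | #|A| == 2}.
Definition letter (n : nat) := (edge n * bool)%type.

Fact edge_subproof n (s t : 'I_n) : s != t -> #|[set s; t]| == 2.
Proof. by rewrite cards2 => ->. Qed.

Definition a_ n (s t : 'I_n) (st : s != t) (e : bool) : letter n :=
  (exist _ [set s; t] (edge_subproof st), e).

Inductive Gnp2_rel (n : nat) : seq (letter n) -> seq (letter n) -> Prop :=
| Gnp2_sq (s t : 'I_n) (st : s != t) (e : bool) :
    Gnp2_rel [:: a_ st e; a_ st e] [::]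
| Gnp2_comm (s t u v : 'I_n) (st : s != t) (uv : u != v) (e e' : bool) :
    uniq [:: s; t; u; v] ->
    Gnp2_rel [:: a_ st e; a_ uv e'] [:: a_ uv e'; a_ st e]
| Gnp2_triple (s t u : 'I_n) (st : s != t) (su : s != u) (tu : t != u)
    (e_st e_su e_tu : bool) :
    (e_st + e_su + e_tu)%N = 0 %[mod 2] ->
    Gnp2_rel [:: a_ st e_st; a_ su e_su; a_ tu e_tu]
             [:: a_ tu e_tu; a_ su e_su; a_ st e_st].

Definition Gnp2 (n : nat) := presented (@Gnp2_rel n).
HB.instance Definition _ n := Group.on (Gnp2 n).

Definition Gnp2_gen n (x : letter n) : Gnp2 n := pgen (@Gnp2_rel n) x.

(* The element of G_{n,p}^2 represented by a word in the generators. *)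
Definition Gnp2_eval n (beta : seq (letter n)) : Gnp2 n :=
  \prod_(x <- beta) Gnp2_gen x.

Definition others n (i j : 'I_n) := {k : 'I_n | (k != i) && (k != j)}.
Definition Fmap n (i j : 'I_n) := {ffun others i j -> 'Z_2}.

Inductive Fn2_rel n (i j : 'I_n) : seq (Fmap i j) -> seq (Fmap i j) -> Prop :=
| Fn2_sq (sigma : Fmap i j) : Fn2_rel [:: sigma; sigma] [::].

Definition Fn2 n (i j : 'I_n) := presented (@Fn2_rel n i j).
HB.instance Definition _ n i j := Group.on (@Fn2 n i j).

Definition Fn2_gen n (i j : 'I_n) (sigma : Fmap i j) : Fn2 i j :=
  pgen (@Fn2_rel n i j) sigma.

Definition is_edge n (s t : 'I_n) (x : letter n) : bool :=
  val x.1 == [set s; t].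

(* N_{st}^d: the number of letters a_{st}^d in the word pre. *)
Definition Nocc n (s t : 'I_n) (d : bool) (pre : seq (letter n)) : nat :=
  count (fun x => is_edge s t x && (x.2 == d)) pre.

(* i^p_c for an occurrence c of a_{ij}^e preceded by the word pre. *)
Definition ip n (i j : 'I_n) (pre : seq (letter n)) (e : bool) : Fmap i j :=
  [ffun k : others i j =>
     if e then ((Nocc i (val k) false pre + Nocc j (val k) true pre)%N%:R)%R
     else ((Nocc i (val k) false pre + Nocc j (val k) false pre)%N%:R)%R].

Definition wp n (i j : 'I_n) (beta : seq (letter n)) : Fn2 i j :=
  \prod_(s < size beta | is_edge i j (tnth (in_tuple beta) s))
    Fn2_gen (ip i j (take s beta) (tnth (in_tuple beta) s).2).

(* Main.v *)
Require Import Defs.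
From mathcomp Require Import all_boot.
From mathcomp Require Import fingroup ssralg zmodp.

(** Read a word from left to right, remembering of the prefix [pre] read so far
    only the two vectors [ip i j pre false] and [ip i j pre true] of counts
    modulo 2.  A letter translates these vectors by an amount that depends on
    the letter alone ([ip_cat]), and a letter on the edge ij also contributes
    one generator of F_n^2, read off from the current vectors.  So [wp] is the
    output of an automaton, here started after an arbitrary prefix ([wp_after]).
    Call two words indistinguishable if they translate the vectors equally and
    have the same output after every prefix ([wp_equiv]); this is a congruence,
    and it remains to see that it contains the defining relations.

    Relations preserve the translation because translations commute and are
    2-torsion.  As for the output:
    - in the square of a letter on ij, the two generators coincide, as such a
      letter does not move the vectors ([ip_edge_ij]), and they cancel;
    - in a commutation relation involving a letter on ij, the other letter avoids
      both i and j, so it does not move the vectors either ([ip_avoid]);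
    - in a triple relation on i, j, k the letters on ik and jk change sides of
      the letter on ij of label e.  The parity condition says exactly that these
      two letters translate the vector of index e by the same amount
      ([ip_triangle]), so, modulo 2, both sides of the relation emit the same
      generator.

    Each letter being its own inverse for the automaton, a signed word can be
    read by forgetting its signs, and free cancellation becomes the relation
    [x x = 1]. *)

Set Implicit Arguments.
Unset Strict Implicit.
Unset Printing Implicit Defensive.

Import GRing.Theory.
Local Open Scope group_scope.

(** * Counting vectors modulo 2 *)

Lemma addZ2_self (x : 'Z_2) : (x + x)%R = 0%R.
Proof. by apply: val_inj; case: x => [[|[|m]]]. Qed.

Lemma is_edgeE n (s t : 'I_n) (x : letter n) :
  s != t -> is_edge s t x = (s \in val x.1) && (t \in val x.1).
Proof.
move=> st; rewrite /is_edge eq_sym eqEcard cards2 st (eqP (valP x.1)) leqnn andbT.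
by rewrite subUset !sub1set.
Qed.

Section Vectors.
Variables (n : nat) (i j : 'I_n).
Implicit Types (x : letter n) (u v pre : seq (letter n)).

Lemma ip_cat u v d : ip i j (u ++ v) d = (ip i j u d + ip i j v d)%R.
Proof.
apply/ffunP=> k; rewrite !ffunE /Nocc !count_cat.
by case: d; rewrite !natrD addrACA.
Qed.

Lemma ip_self u d : (ip i j u d + ip i j u d)%R = 0%R.
Proof. by apply/ffunP=> k; rewrite ffunE [RHS]ffunE addZ2_self. Qed.

Lemma ip_perm u v d : perm_eq u v -> ip i j u d = ip i j v d.
Proof.
by move=> /permP uv; apply/ffunP=> k; rewrite !ffunE /Nocc !uv.
Qed.

Lemma ip_nil d : ip i j [::] d = 0%R.
Proof. by apply/ffunP=> k; rewrite !ffunE; case: d. Qed.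

Lemma ip_letterE x d (k : others i j) :
  ip i j [:: x] d k =
    (((val k \in val x.1) && ((i \in val x.1) && ~~ x.2)
    + (val k \in val x.1) && ((j \in val x.1) && (x.2 == d)))%N%:R)%R.
Proof.
have /andP[ki kj] := valP k.
rewrite ffunE /Nocc /= !addn0 !is_edgeE 1?eq_sym //.
by case: d; congr (_%:R)%R; case: x.2; case: (val k \in _); case: (i \in _);
  case: (j \in _).
Qed.

Lemma ip_edge_ij x d : is_edge i j x -> ip i j [:: x] d = 0%R.
Proof.
move=> /eqP Ex; apply/ffunP=> k; rewrite ip_letterE Ex !ffunE !inE.
by have /andP[/negPf-> /negPf->] := valP k.
Qed.

Lemma ip_avoid x d :
  i \notin val x.1 -> j \notin val x.1 -> ip i j [:: x] d = 0%R.
Proof.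
move=> /negPf ix /negPf jx; apply/ffunP=> k.
by rewrite ip_letterE ix jx !andbF ffunE.
Qed.

(** Let st = ij.  If s = i, then [a] moves the coordinate of [u] when its label
    is 0, and [b] moves it when its label is [d]; the parity condition makes
    these two events the same.  If s = j, exchange [a] and [b]. *)
Lemma ip_triangle (s t u : 'I_n) (a b : letter n) d :
    [set s; t] = [set i; j] -> val a.1 = [set s; u] -> val b.1 = [set t; u] ->
    s != t -> s != u -> t != u -> d (+) a.2 (+) b.2 = false ->
  ip i j [:: a] d = ip i j [:: b] d.
Proof.
move=> eij Ea Eb st su tu par; apply/ffunP=> k.
rewrite !ip_letterE Ea Eb; have /andP[ki kj] := valP k.
have [/negPf ts /negPf us /negPf ut] : [/\ t != s, u != s & u != t].
  by rewrite ![_ == s]eq_sym [u == t]eq_sym.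
have: s \in [set i; j] by rewrite -eij set21.
have: t \in [set i; j] by rewrite -eij set22.
rewrite !inE => /orP[]/eqP ? /orP[]/eqP ?; subst s t;
  rewrite ?eqxx // in st *;
  rewrite (negPf ki) (negPf kj) (negPf st) (negPf su) (negPf tu) ts /=;
  by case: (_ == u); case: d par; case: a.2; case: b.2.
Qed.

(** * The output after a prefix *)

Definition emit pre x : Fn2 i j :=
  if is_edge i j x then Fn2_gen (ip i j pre x.2) else 1.

Fixpoint wp_after pre u : Fn2 i j :=
  if u is x :: u' then emit pre x * wp_after (rcons pre x) u' else 1.

Lemma wp_afterE pre u :
  wp_after pre u =
    \prod_(s < size u | is_edge i j (tnth (in_tuple u) s))
      Fn2_gen (ip i j (pre ++ take s u) (tnth (in_tuple u) s).2).
Proof.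
elim: u pre => [|x u IHu] pre /=; first by rewrite big_ord0.
rewrite big_mkcond big_ord_recl /= IHu [in LHS]big_mkcond /=.
rewrite (tnth_nth x) /= cats0; congr (_ * _).
apply: eq_bigr => s _.
by rewrite !(tnth_nth x) /= cat_rcons.
Qed.

Lemma wp_after_nil u : wp i j u = wp_after [::] u.
Proof. by rewrite wp_afterE. Qed.

Lemma wp_after_cat pre u v :
  wp_after pre (u ++ v) = wp_after pre u * wp_after (pre ++ u) v.
Proof.
elim: u pre => [|x u IHu] pre /=; first by rewrite mul1g cats0.
by rewrite IHu mulgA cat_rcons.
Qed.

Lemma eq_emit pre pre' x :
  (forall d, ip i j pre d = ip i j pre' d) -> emit pre x = emit pre' x.
Proof. by move=> e; rewrite /emit e. Qed.

(** This makes [wp_equiv] below stable under concatenation: replacing a word by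
    an equivalent one does not change what is read after it. *)
Lemma eq_wp_after pre pre' u :
    (forall d, ip i j pre d = ip i j pre' d) ->
  wp_after pre u = wp_after pre' u.
Proof.
elim: u pre pre' => [//|x u IHu] pre pre' e /=; rewrite (eq_emit x e).
by congr (_ * _); apply: IHu => d; rewrite -!cats1 !ip_cat e.
Qed.

Lemma Fn2_gen_sq (sigma : Fmap i j) : Fn2_gen sigma * Fn2_gen sigma = 1.
Proof.
have := presented_rel (Fn2_sq sigma).
by rewrite !big_cons !big_nil mulg1.
Qed.

Definition wp_equiv u v :=
  (forall d, ip i j u d = ip i j v d) /\
  (forall pre, wp_after pre u = wp_after pre v).

Lemma wp_equiv_cat u u' v v' :
  wp_equiv u u' -> wp_equiv v v' -> wp_equiv (u ++ v) (u' ++ v').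
Proof.
move=> [eu wu] [ev wv]; split=> [d|pre]; first by rewrite !ip_cat eu ev.
rewrite !wp_after_cat wu wv; congr (_ * _).
by apply: eq_wp_after => d; rewrite !ip_cat eu.
Qed.

(** * The defining relations *)

Lemma wp_equiv_sq x : wp_equiv [:: x; x] [::].
Proof.
split=> [d|pre /=]; first by rewrite (ip_cat [:: x] [:: x]) ip_self ip_nil.
rewrite mulg1 /emit; case: ifP => [ex|_]; last by rewrite mulg1.
by rewrite -cats1 ip_cat (ip_edge_ij _ ex) addr0 Fn2_gen_sq.
Qed.

Lemma emit_avoid pre (x y : letter n) :
  [disjoint val x.1 & val y.1] -> emit (rcons pre y) x = emit pre x.
Proof.
move=> dxy; rewrite /emit; case: ifP => // /eqP Ex.
rewrite -cats1 ip_cat ip_avoid ?addr0 //.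
  by rewrite (disjointFr dxy) // Ex set21.
by rewrite (disjointFr dxy) // Ex set22.
Qed.

Lemma wp_equiv_comm (x y : letter n) :
  [disjoint val x.1 & val y.1] -> wp_equiv [:: x; y] [:: y; x].
Proof.
move=> dxy; split=> [d|pre /=].
  by apply: ip_perm; rewrite (perm_catC [:: x] [:: y]).
rewrite !mulg1 (emit_avoid pre dxy) emit_avoid 1?disjoint_sym //.
have [ex|nex] := boolP (is_edge i j x); last first.
  by rewrite /emit (negPf nex) mulg1 mul1g.
(* The edges of x and y are disjoint, so only one of them can be ij. *)
have ney : is_edge i j y = false.
  apply/negP=> /eqP Ey; have := disjointFr dxy (x := i).
  by rewrite (eqP ex) Ey set21 => /(_ isT).
by rewrite /emit ney mulg1 mul1g.
Qed.

(** At most one of the three letters emits; in each of the three cases the other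
    two contribute the same amount to the vector it reads. *)
Lemma wp_equiv_triple (s t u : 'I_n) (x y z : letter n) :
    s != t -> s != u -> t != u ->
    val x.1 = [set s; t] -> val y.1 = [set s; u] -> val z.1 = [set t; u] ->
    x.2 (+) y.2 (+) z.2 = false ->
  wp_equiv [:: x; y; z] [:: z; y; x].
Proof.
move=> st su tu Ex Ey Ez par; split=> [d|pre /=].
  by apply: ip_perm; rewrite -[[:: z; y; x]]/(rev [:: x; y; z]) perm_sym perm_rev.
have [ts us ut] : [/\ t != s, u != s & u != t].
  by rewrite ![_ == s]eq_sym [u == t]eq_sym.
rewrite /emit !mulg1 -!cats1 !ip_cat /is_edge Ex Ey Ez.
have nyz : ([set s; u] == [set i; j]) && ([set t; u] == [set i; j]) = false.
  apply/negP=> /andP[/eqP<- /eqP/setP/(_ s)].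
  by rewrite !inE eqxx (negPf st) (negPf su).
have nxy : ([set s; t] == [set i; j]) && ([set s; u] == [set i; j]) = false.
  apply/negP=> /andP[/eqP<- /eqP/setP/(_ t)].
  by rewrite !inE eqxx (negPf ts) (negPf tu) orbT.
have nxz : ([set s; t] == [set i; j]) && ([set t; u] == [set i; j]) = false.
  apply/negP=> /andP[/eqP<- /eqP/setP/(_ s)].
  by rewrite !inE eqxx (negPf st) (negPf su).
have [ex|_] := eqVneq [set s; t] [set i; j].
  move: nxy nxz; rewrite ex eqxx /= => -> ->; rewrite !mulg1 !mul1g.
  rewrite -addrA (@ip_triangle s t u y z) ?ip_self ?addr0 //.
have [ey|_] := eqVneq [set s; u] [set i; j].
  move: nyz; rewrite ey eqxx /= => ->; rewrite !mulg1 !mul1g.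
  rewrite (@ip_triangle s u t x z) // 1?setUC 1?[in RHS]setUC //.
    by rewrite Ez setUC.
  by rewrite [y.2 (+) _]addbC.
case: eqVneq => [ez|_]; last by rewrite !mulg1.
rewrite !mulg1 !mul1g -addrA (@ip_triangle t u s x y) ?ip_self ?addr0 //.
- by rewrite Ex setUC.
- by rewrite Ey setUC.
- by rewrite addbC addbA in par *.
Qed.

Lemma wp_equiv_rel u v : Gnp2_rel u v -> wp_equiv u v.
Proof.
case=> [s t st e|s t k l st kl e e' uq|s t k st sk tk e1 e2 e3 par].
- exact: wp_equiv_sq.
- apply: wp_equiv_comm; rewrite /= -setI_eq0; apply/eqP/setP=> m.
  rewrite !inE; apply/negP=> /andP[/orP[]/eqP-> /orP[]/eqP E];
    by move: uq; rewrite /= !inE E eqxx ?orbT ?andbF.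
- apply: (wp_equiv_triple st sk tk) => //=.
  by case: e1 e2 e3 par => [] [] [].
Qed.

Lemma wp_equiv_pres (u v : sword (letter n)) :
  pres_eq (@Gnp2_rel n) u v -> wp_equiv (map fst u) (map fst v).
Proof.
have posK w : map fst (pos w) = w :> seq (letter n).
  by rewrite /pos -map_comp map_id.
elim=> {u v} [u|u v _ [e w]|u v w _ [e1 w1] _ [e2 w2]|u u' v v' _ eu _ ev|x b
             |u v uv].
- by split.
- by split=> *; rewrite ?e ?w.
- by split=> *; rewrite ?e1 ?w1.
- by rewrite !map_cat; apply: wp_equiv_cat.
- exact: wp_equiv_sq.
- by rewrite !posK; apply: wp_equiv_rel.
Qed.

End Vectors.

Theorem lemma4p7 (n : nat) (i j : 'I_n) (hn : 2 <= n) (hij : i != j)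
    (beta beta' : seq (letter n)) :
  Gnp2_eval beta = Gnp2_eval beta' -> wp i j beta = wp i j beta'.
Proof.
rewrite /Gnp2_eval /Gnp2_gen -!pres_class_pos => /pres_classP/(wp_equiv_pres i j).
rewrite /pos -!map_comp !map_id => -[_ w].
by rewrite !wp_after_nil w.
Qed.
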